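(* Let $G$ be an acyclic ADT network and let $\mathcal C=\{(S,T_1,\mathcal X(S)),\dots,(S,T_N,\mathcal X(S))\}$ be a single multicast connection. Then $(G,\mathcal C)$ is solvable if and only if $\mathrm{mincut}(S,T_i)\ge|\mathcal X(S)|$ for all $i=1,\dots,N$.
   Context: ADT network model. $G=(\mathcal V,\mathcal E)$ is a directed acyclic network of supernodes, each with input ports $I(V)$ and output ports $O(V)$. Edges go from output ports to input ports of other supernodes. Linear coding over a finite field $\mathbb F_q$: - An output port $e\in O(V)$ carries $Y(e)=\sum_{e'\in I(V)}\beta_{(e',e)}Y(e')$. At the source $S$, the term $\sum_i\alpha_{(i,e)}X(S,i)$ is added, where $\mathcal X(S)=[X(S,1),\dots,X(S,\mu(S))]$ are the independent source processes. - An output port sends the same symbol on all of its outgoing edges (broadcast). - An input port $e'$ receives $Y(e')=\sum_{(e,e')\in\mathcal E}Y(e)$, the sum taken over $\mathbb F_q$. - A destination $T$ outputs $Z(T,k)=\sum_{e'\in I(T)}\epsilon_{(e',(T,k))}Y(e')$. $(G,\mathcal C)$ is solvable if some single choice of coefficients $\alpha,\beta,\epsilon$ makes every destination $T_i$ output exactly $\mathcal X(S)$. Following the paper's convention, the field size $q$ may be chosen as large as needed, so solvable means solvable by linear coding over some sufficiently large $\mathbb F_q$. $\mathrm{mincut}(S,T)=\min_\Omega\mathrm{rank}(G_\Omega)$, with the minimum over partitions $\Omega\cup\Omega^c$ of the supernodes with $S\in\Omega$ and $T\in\Omega^c$. $G_\Omega$ is the $0$-$1$ incidence matrix of the edges from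 output ports of supernodes in $\Omega$ to input ports of supernodes in $\Omega^c$. *)

(* Defs.v *)
From HB Require Import structures.
From mathcomp Require Import all_boot all_order all_algebra all_field.
Set Implicit Arguments. Unset Strict Implicit. Unset Printing Implicit Defensive.
Import GRing.Theory.
Local Open Scope ring_scope.

(* An ADT network: supernodes of type V (a finType); nO output ports and
   nI input ports, each owned by a supernode (outV / inV); an edge relation
   E o i : output port o -> input port i. *)

Definition snode_rel (V : finType) (nO nI : nat)
  (outV : 'I_nO -> V) (inV : 'I_nI -> V) (E : 'I_nO -> 'I_nI -> bool) : rel V :=
  fun u v => [exists o, exists i, [&& E o i, outV o == u & inV i == v]].

Definition acyclic_net (V : finType) (nO nI : nat)
  (outV : 'I_nO -> V) (inV : 'I_nI -> V) (E : 'I_nO -> 'I_nI -> bool) : Prop :=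
  forall v : V, ~~ [exists u, snode_rel outV inV E v u &&
                               connect (snode_rel outV inV E) u v].

(* A linear code over the field F solving the multicast of the mu source
   processes of S to all destinations T j: coefficients alpha, beta, eps are
   chosen once; for every source value x, the port symbols Yo/Yi obey the
   network equations and every destination T j outputs exactly x. *)
Definition linear_solution (F : fieldType) (V : finType) (nO nI : nat)
  (outV : 'I_nO -> V) (inV : 'I_nI -> V) (E : 'I_nO -> 'I_nI -> bool)
  (S : V) (mu N : nat) (T : 'I_N -> V) : Prop :=
  exists (alpha : 'I_mu -> 'I_nO -> F) (beta : 'I_nI -> 'I_nO -> F)
         (eps : 'I_N -> 'I_nI -> 'I_mu -> F),
  forall x : 'I_mu -> F,
  exists (Yo : 'I_nO -> F) (Yi : 'I_nI -> F),
    (forall i, Yi i = \sum_(o | E o i) Yo o) /\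
    (forall o, Yo o = \sum_(i | inV i == outV o) beta i o * Yi i
                      + (if outV o == S then \sum_k alpha k o * x k else 0)) /\
    (forall j k, \sum_(i | inV i == T j) eps j i k * Yi i = x k).

Definition solvable (p : nat) (V : finType) (nO nI : nat)
  (outV : 'I_nO -> V) (inV : 'I_nI -> V) (E : 'I_nO -> 'I_nI -> bool)
  (S : V) (mu N : nat) (T : 'I_N -> V) : Prop :=
  exists F : finFieldType, p \in [pchar F] /\
    linear_solution F outV inV E S mu T.

(* G_Omega: 0-1 incidence matrix of edges from output ports of supernodes in
   Omega to input ports of supernodes outside Omega (rows/columns of other
   ports are zero, which does not change the rank), over 'F_p. *)
Definition cut_matrix (p : nat) (V : finType) (nO nI : nat)
  (outV : 'I_nO -> V) (inV : 'I_nI -> V) (E : 'I_nO -> 'I_nI -> bool)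
  (Om : {set V}) : 'M['F_p]_(nO, nI) :=
  \matrix_(o < nO, i < nI)
     (if [&& outV o \in Om, inV i \notin Om & E o i] then 1 else 0).

Definition mincut (p : nat) (V : finType) (nO nI : nat)
  (outV : 'I_nO -> V) (inV : 'I_nI -> V) (E : 'I_nO -> 'I_nI -> bool)
  (S t : V) : nat :=
  \big[minn/nO]_(Om : {set V} | (S \in Om) && (t \notin Om))
     \rank (cut_matrix p outV inV E Om).

(* Main.v *)
(** Necessity: by acyclicity the signals outside a cut Om are determined by
    y *m cut_mx Om, where y is the vector of output symbols, so a code that
    resolves x at t makes x |-> y *m cut_mx Om injective.

    Sufficiency: choose the code uniformly at random over a field with q
    elements.  Fix x <> 0 and a vector y of output symbols, and let Om consist
    of S and the supernodes that receive a nonzero symbol.  Each output port in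
    Om emits its prescribed symbol with probability 1/q, the other ones must
    carry 0, and the y compatible with Om lie in a space of dimension (number of
    output ports in Om) - rank G_Om.  Hence x reaches t as 0 with probability at
    most 2^|V| / q^mu.  The number of x <> 0 up to scaling is
    (q^mu - 1) / (q - 1), so a union bound over lines (not over vectors) leaves
    a good code as soon as q > N 2^|V|. *)
Require Import Defs.
From mathcomp Require Import all_boot all_order all_algebra all_field mxabelem.
Set Implicit Arguments. Unset Strict Implicit. Unset Printing Implicit Defensive.
Import GRing.Theory.

(** * Induction along an acyclic network *)

Section Acyclic.
Variables (V : finType) (nO nI : nat) (outV : 'I_nO -> V) (inV : 'I_nI -> V).
Variable E : 'I_nO -> 'I_nI -> bool.
Hypothesis acyc : acyclic_net outV inV E.
Let e := snode_rel outV inV E.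

(** A member of [P] with the fewest ancestors cannot have a predecessor [u] in [P]: the ancestors of
    [u] are among those of [w], and acyclicity keeps [w] itself out of them. *)
Lemma acyclic_net_source (P : pred V) :
  (forall v, P v -> exists2 u, P u & e u v) -> forall v, ~~ P v.
Proof.
move=> Ppred v; apply/negP=> Pv.
pose anc w := #|[set u | connect e u w]|.
case: (arg_minnP anc Pv) => w Pw minw.
have [u Pu euw] := Ppred w Pw.
have := minw u Pu; rewrite leqNgt => /negP; apply.
apply: proper_card; apply/properP; split.
  apply/subsetP=> z; rewrite !inE => /connect_trans; apply.
  exact: connect1.
exists w; first by rewrite inE connect0.
rewrite inE; apply/negP=> wu; have /negP := acyc u; apply.
by apply/existsP; exists w; apply/andP.
Qed.

End Acyclic.

Local Open Scope ring_scope.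

(** * Linear algebra of a fixed code: transfer matrix, decodability, cut bound *)

Section Transfer.
Variables (F : fieldType) (V : finType) (nO nI : nat).
Variables (outV : 'I_nO -> V) (inV : 'I_nI -> V) (E : 'I_nO -> 'I_nI -> bool).
Variables (S : V) (mu : nat).

Definition adj_mx : 'M[F]_(nO, nI) := \matrix_(o, i) (E o i)%:R.

Definition cut_mx (Om : {set V}) : 'M[F]_(nO, nI) :=
  \matrix_(o, i) [&& outV o \in Om, inV i \notin Om & E o i]%:R.

(** Masking the entries at ports foreign to [S] lets [a] range over all matrices, so that it can be
    drawn without constraint; [relay_mx] does the same for [b]. *)
Definition inject_mx (a : 'M[F]_(mu, nO)) : 'M[F]_(mu, nO) :=
  \matrix_(k, o) (if outV o == S then a k o else 0).

Definition relay_mx (b : 'M[F]_(nI, nO)) : 'M[F]_(nI, nO) :=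
  \matrix_(i, o) (if inV i == outV o then b i o else 0).

(** The network equations, solved for the row vector of output symbols. *)
Definition transfer_mx a b : 'M[F]_(mu, nO) :=
  inject_mx a *m invmx (1%:M - adj_mx *m relay_mx b).

(** Decodability at [t] as a trivial kernel, which avoids naming the decoder [eps]. *)
Definition resolves a b (t : V) : Prop :=
  forall x : 'rV[F]_mu,
  (forall i, inV i = t -> (x *m transfer_mx a b *m adj_mx) 0 i = 0) -> x = 0.

Lemma adj_mxE (y : 'rV[F]_nO) i : (y *m adj_mx) 0 i = \sum_(o | E o i) y 0 o.
Proof.
rewrite mxE [RHS]big_mkcond; apply: eq_bigr => o _; rewrite mxE.
by case: (E o i); rewrite ?mulr1 ?mulr0.
Qed.

Lemma relay_mxE b (z : 'rV[F]_nI) o :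
  (z *m relay_mx b) 0 o = \sum_(i | inV i == outV o) b i o * z 0 i.
Proof.
rewrite mxE [RHS]big_mkcond; apply: eq_bigr => i _; rewrite mxE mulrC.
by case: eqP; rewrite ?mul0r.
Qed.

Lemma inject_mxE a (x : 'rV[F]_mu) o :
  (x *m inject_mx a) 0 o = if outV o == S then \sum_k a k o * x 0 k else 0.
Proof.
rewrite mxE; case: ifP => outo.
  by apply: eq_bigr => k _; rewrite mxE outo mulrC.
by apply: big1 => k _; rewrite mxE outo mulr0.
Qed.

Lemma cut_mxE (Om : {set V}) (y : 'rV[F]_nO) i : inV i \notin Om ->
  (y *m cut_mx Om) 0 i = \sum_(o | E o i) (if outV o \in Om then y 0 o else 0).
Proof.
move=> iOm; rewrite mxE [RHS]big_mkcond; apply: eq_bigr => o _.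
rewrite mxE iOm /=.
by case: (outV o \in Om); case: (E o i); rewrite ?mulr1 ?mulr0.
Qed.

Lemma adj_mx_cut (Om : {set V}) (y : 'rV[F]_nO) i : inV i \notin Om ->
    (forall o, outV o \notin Om -> y 0 o = 0) ->
  (y *m adj_mx) 0 i = (y *m cut_mx Om) 0 i.
Proof.
move=> iOm y0; rewrite adj_mxE cut_mxE //; apply: eq_bigr => o _.
by case: ifPn => // /y0.
Qed.

Hypothesis acyc : acyclic_net outV inV E.

(** Suppose a supernode outside [Om] emits a nonzero symbol. Since [z] vanishes there, it receives a
    nonzero symbol; the cut contributes 0 to that input port, so the symbol comes from an emitting
    predecessor outside [Om]. Acyclicity forbids this regress. *)
Lemma cut_mx_eq0_outside b (y z : 'rV[F]_nO) (Om : {set V}) :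
    y = y *m adj_mx *m relay_mx b + z ->
    (forall o, outV o \notin Om -> z 0 o = 0) -> y *m cut_mx Om = 0 ->
  forall o, outV o \notin Om -> y 0 o = 0.
Proof.
move=> ydef z0 ycut o oOm.
pose P v := (v \notin Om) && [exists o, (outV o == v) && (y 0 o != 0)].
have := @acyclic_net_source _ _ _ _ _ _ acyc P _ (outV o).
rewrite /P oOm /= => noP; apply/eqP; apply: contraT => yo.
have /negP[] : ~~ [exists o0, (outV o0 == outV o) && (y 0 o0 != 0)]; last first.
  by apply/existsP; exists o; rewrite eqxx.
apply: noP => v {o oOm yo} /andP[vOm /existsP[o /andP[/eqP ov yo]]].
have [i /andP[/eqP iv yi]] : exists i, (inV i == outV o) && ((y *m adj_mx) 0 i != 0).
  apply/existsP; move: yo; apply: contraR; rewrite negb_exists => /forallP yi0.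
  rewrite ydef mxE z0 ?ov // addr0 relay_mxE big1 // => i iv.
  by have := yi0 i; rewrite iv negbK => /eqP->; rewrite mulr0.
have iOm : inV i \notin Om by rewrite iv ov.
have [o' /and3P[Eoi o'Om yo']] :
    exists o', [&& E o' i, outV o' \notin Om & y 0 o' != 0].
  apply/existsP; move: yi; apply: contraR; rewrite negb_exists => /forallP yo0.
  have /matrixP/(_ 0 i) := ycut; rewrite cut_mxE // [RHS]mxE adj_mxE => sum0.
  apply/eqP; rewrite -[RHS]sum0; apply: eq_bigr => o' Eoi; case: ifPn => // o'Om.
  by have := yo0 o'; rewrite Eoi o'Om negbK => /eqP.
exists (outV o').
  by rewrite o'Om; apply/existsP; exists o'; rewrite eqxx.
apply/existsP; exists o'; apply/existsP; exists i.
by rewrite Eoi eqxx iv ov eqxx.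
Qed.

(** A kernel vector is a circulation without injected symbols; the empty cut already forces it to
    vanish. *)
Lemma network_unit b : 1%:M - adj_mx *m relay_mx b \in unitmx.
Proof.
rewrite -row_free_unit; apply: inj_row_free => y.
rewrite mulmxBr mulmx1 mulmxA => /eqP; rewrite subr_eq0 => /eqP ydef.
apply/rowP=> o; rewrite [RHS]mxE.
apply: (@cut_mx_eq0_outside b y 0 set0); rewrite ?inE ?addr0 //.
  by move=> o' _; rewrite mxE.
apply/rowP=> i; rewrite cut_mxE ?inE // mxE big1 // => o' _.
by rewrite inE.
Qed.

Lemma transfer_mxP a b (x : 'rV[F]_mu) (y : 'rV[F]_nO) :
  y = y *m adj_mx *m relay_mx b + x *m inject_mx a <-> y = x *m transfer_mx a b.
Proof.
have U := network_unit b; rewrite /transfer_mx mulmxA; split.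
  move/eqP; rewrite addrC -subr_eq -mulmxA -{1}[y]mulmx1 -mulmxBr => /eqP <-.
  by rewrite mulmxK.
move=> ydef; apply/eqP; rewrite addrC -subr_eq -mulmxA -{1}[y]mulmx1 -mulmxBr.
by rewrite ydef mulmxKV.
Qed.

(** Forward, the network equations have only one solution, so the given symbols are those of
    [transfer_mx]. Backward, a trivial kernel yields a decoder. *)
Lemma linear_solutionP N (T : 'I_N -> V) :
  linear_solution F outV inV E S mu T <->
  exists a b, forall j, resolves a b (T j).
Proof.
split.
  case=> [a [b [d sol]]].
  exists (\matrix_(k, o) a k o), (\matrix_(i, o) b i o) => j x xj.
  have [Yo [Yi [YiE [YoE decode]]]] := sol (x 0).
  pose y := \row_o Yo o.
  have yi i : (y *m adj_mx) 0 i = Yi i.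
    by rewrite adj_mxE YiE; apply: eq_bigr => o _; rewrite mxE.
  have ydef : y = x *m transfer_mx (\matrix_(k, o) a k o) (\matrix_(i, o) b i o).
    apply/transfer_mxP/rowP=> o; rewrite [RHS]mxE relay_mxE inject_mxE mxE YoE.
    congr (_ + _); first by apply: eq_bigr => i _; rewrite yi mxE.
    by case: ifP => // _; apply: eq_bigr => k _; rewrite mxE.
  apply/rowP=> k; rewrite -(decode j k) mxE big1 // => i /eqP iT.
  by rewrite -yi ydef xj // mulr0.
case=> a [b res].
pose Y := transfer_mx a b.
(* The diagonal factor keeps only the input ports of [T j]. Then [W j] is row free, and its right
   inverse [pinvmx (W j)] is the decoder. *)
pose W j : 'M[F]_(mu, nI) := Y *m adj_mx *m diag_mx (\row_i (inV i == T j)%:R).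
have WE j (x : 'rV[F]_mu) i :
    (x *m W j) 0 i = (x *m Y *m adj_mx) 0 i * (inV i == T j)%:R.
  by rewrite /W !mulmxA mul_mx_diag !mxE.
have Wfree j : row_free (W j).
  apply: inj_row_free => x xW; apply: (res j) => i iT.
  by move/matrixP/(_ 0 i): xW; rewrite WE iT eqxx mulr1 => ->; rewrite mxE.
exists a, b, (fun j i k => pinvmx (W j) i k) => x.
pose xr := \row_k x k; pose y := xr *m Y.
exists (y 0), ((y *m adj_mx) 0); split; first by move=> i; rewrite adj_mxE.
split=> [o|j k].
  have {1}-> : y = y *m adj_mx *m relay_mx b + xr *m inject_mx a.
    exact/transfer_mxP.
  rewrite mxE relay_mxE inject_mxE; congr (_ + _).
  by case: ifP => // _; apply: eq_bigr => k _; rewrite mxE.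
have <- : xr 0 k = x k by rewrite mxE.
rewrite -[in RHS](mulmxKp (Wfree j) xr) mxE big_mkcond; apply: eq_bigr => i _.
by rewrite WE mulrC; case: eqP; rewrite ?mulr1 ?mulr0 ?mul0r.
Qed.

(** If [x] puts zero on the cut, nothing is emitted outside [Om], so [t] receives zero and [x = 0].
    The product of transfer and cut matrices thus has rank [mu]. *)
Lemma resolves_rank_cut a b t (Om : {set V}) :
  resolves a b t -> S \in Om -> t \notin Om -> (mu <= \rank (cut_mx Om))%N.
Proof.
move=> res SOm tOm.
have /eqP <- : row_free (transfer_mx a b *m cut_mx Om); last exact: mxrankM_maxr.
apply: inj_row_free => x; rewrite mulmxA => xcut; apply: res => i it.
have iOm : inV i \notin Om by rewrite it.
rewrite (adj_mx_cut iOm) ?xcut ?mxE //.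
have /transfer_mxP ydef := erefl (x *m transfer_mx a b).
apply: (cut_mx_eq0_outside ydef) => // o oOm.
by rewrite inject_mxE; case: eqP oOm => // ->; rewrite SOm.
Qed.

End Transfer.

(** * Counting solutions of linear systems over a finite field *)

Section Counting.
Variable F : finFieldType.
Local Notation q := #|F|.

Lemma card_kernel m n (A : 'M[F]_(m, n)) :
  (#|[set u : 'rV_m | u *m A == 0]%R| * q ^ \rank A = q ^ m)%N.
Proof.
have -> : [set u : 'rV_m | u *m A == 0] = rowg (kermx A).
  by apply/setP=> u; rewrite !inE; apply/eqP/sub_kermxP.
by rewrite card_rowg mxrank_ker -expnD subnK ?rank_leq_row.
Qed.

(** The solution set is empty or a translate of part of the kernel of [w], which has rank 1. *)
Lemma card_affine_hyperplane m (w : 'cV[F]_m) (c : 'M[F]_1) : w != 0 ->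
  (#|[set u : 'rV_m | u *m w == c]| * q <= q ^ m)%N.
Proof.
move=> w0; have rw : \rank w = 1%N.
  by apply/eqP; rewrite eqn_leq rank_leq_col lt0n mxrank_eq0.
have [->|[u0]] := set_0Vmem [set u : 'rV_m | u *m w == c]; first by rewrite cards0.
rewrite inE => /eqP u0c; rewrite -(card_kernel w) rw expn1 leq_mul2r.
apply/orP; right; rewrite -(card_imset _ (addIr (- u0))).
apply/subset_leq_card/subsetP=> _ /imsetP[u + ->]; rewrite !inE => /eqP uc.
by rewrite mulmxBl uc u0c subrr.
Qed.

(** The choices at distinct indices are independent, so the count is a product; each index with
    [w o != 0] costs a factor [q]. *)
Lemma card_ffun_affine n m (w : 'I_n -> 'cV[F]_m) (c : 'I_n -> 'M[F]_1) :
  (#|[set g : {ffun 'I_n -> 'rV_m} | [forall o, g o *m w o == c o]]|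
     * q ^ #|[set o | w o != 0%R]| <= #|{ffun 'I_n -> 'rV[F]_m}|)%N.
Proof.
have -> : #|[set g : {ffun 'I_n -> 'rV_m} | [forall o, g o *m w o == c o]]|
    = (\prod_o #|[set u : 'rV_m | u *m w o == c o]|)%N.
  transitivity #|family (fun o => [pred u : 'rV_m | u *m w o == c o])|.
    by rewrite cardsE; apply: eq_card => g; rewrite !inE.
  rewrite card_family foldrE big_map big_enum; apply: eq_bigr => o _.
  by rewrite cardsE.
rewrite card_ffun -!prod_nat_const [X in (_ * X)%N]big_mkcond -big_split /=.
rewrite [leqRHS](eq_bigl xpredT) //; apply: leq_prod => o _; rewrite card_mx mul1n inE.
case: ifPn => [|_]; first exact: card_affine_hyperplane.
by rewrite muln1 (leq_trans (max_card _)) // card_mx mul1n.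
Qed.

(** Dropping the zero rows of [G] outside [A] keeps its rank, and restriction to [A] is injective on
    vectors supported there. *)
Lemma card_kernel_supported n k (G : 'M[F]_(n, k)) (A : {set 'I_n}) :
    (forall o i, o \notin A -> G o i = 0) ->
  (#|[set y : 'rV_n |
        (y *m G == 0) && [forall o, (o \notin A) ==> (y 0 o == 0)]]%R|
     * q ^ \rank G <= q ^ #|A|)%N.
Proof.
move=> G0; pose r := @enum_val _ (mem A); pose G' := rowsub r G.
have rankG : (\rank G <= \rank G')%N.
  apply/mxrankS/row_subP=> o; have [oA|oA] := boolP (o \in A).
    by rewrite -(enum_rankK_in oA oA) -row_rowsub row_sub.
  by rewrite (_ : row o G = 0) ?sub0mx //; apply/rowP=> i; rewrite !mxE G0.
rewrite -(card_kernel G') leq_mul ?leq_pexp2l //; last by apply/card_gt0P; exists 0.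
rewrite -(card_in_imset (f := colsub r)) => [|y z]; last first.
  rewrite !inE => /andP[_ /forallP y0] /andP[_ /forallP z0] /rowP yz.
  apply/rowP=> o; have [oA|oA] := boolP (o \in A).
    by have := yz (enum_rank_in oA o); rewrite !mxE /r enum_rankK_in.
  by have := y0 o; have := z0 o; rewrite oA => /eqP-> /eqP->.
apply/subset_leq_card/subsetP=> _ /imsetP[y + ->].
rewrite !inE => /andP[/eqP yG /forallP y0]; apply/eqP/rowP=> i.
rewrite -yG !mxE [RHS](bigID (mem A)) /= [X in _ + X]big1 ?addr0 => [|o oA]; last first.
  by rewrite G0 ?mulr0.
by rewrite [RHS]big_enum_val; apply: eq_bigr => j _; rewrite !mxE.
Qed.

End Counting.

(** * Failure count of a random code and the union bound *)

Section RandomCode.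
Variables (F : finFieldType) (V : finType) (nO nI : nat).
Variables (outV : 'I_nO -> V) (inV : 'I_nI -> V) (E : 'I_nO -> 'I_nI -> bool).
Variables (S : V) (mu : nat).
Local Notation q := #|F|.
Local Notation code := {ffun 'I_nO -> 'rV[F]_(mu + nI)}.
Local Notation adj := (adj_mx F E).
Local Notation cut := (cut_mx F outV inV E).

(** [g o] lists the coefficients alpha(., o) followed by the beta(., o). *)
Definition code_alpha (g : code) : 'M[F]_(mu, nO) :=
  \matrix_(k, o) g o 0 (lshift nI k).
Definition code_beta (g : code) : 'M[F]_(nI, nO) :=
  \matrix_(i, o) g o 0 (rshift mu i).

(** The symbols that [g o] combines at output port [o]. *)
Definition load (x : 'rV[F]_mu) (y : 'rV[F]_nO) (o : 'I_nO) : 'cV[F]_(mu + nI) :=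
  col_mx (if outV o == S then x^T else 0)
         (\col_i (if inV i == outV o then (y *m adj) 0 i else 0)).

Lemma load_eq (g : code) x y o :
  (y *m adj *m relay_mx outV inV (code_beta g)
     + x *m inject_mx outV S (code_alpha g)) 0 o = (g o *m load x y o) 0 0.
Proof.
rewrite [LHS]mxE relay_mxE inject_mxE [RHS]mxE big_split_ord addrC /=; congr (_ + _).
  case: ifP => outo.
    by apply: eq_bigr => k _; rewrite col_mxEu outo !mxE.
  by rewrite big1 // => k _; rewrite col_mxEu outo !mxE mulr0.
rewrite big_mkcond; apply: eq_bigr => i _; rewrite col_mxEd [X in _ = _ * X]mxE mxE.
by case: ifP; rewrite ?mulr0.
Qed.

Definition seen (y : 'rV[F]_nO) : {set V} :=
  S |: [set v | [exists i, (inV i == v) && ((y *m adj) 0 i != 0)]].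

(** A nonzero [x] enters the load of every port of [S], which is why [seen] always contains [S]. *)
Lemma load_neq0 (x : 'rV[F]_mu) y o : x != 0 -> (load x y o != 0) = (outV o \in seen y).
Proof.
move=> x0; rewrite /load col_mx_eq0 negb_and !inE; congr (_ || _).
  case: (outV o == S); last by rewrite eqxx.
  by rewrite trmx_eq0 x0.
apply/idP/existsP => [|[i /andP[/eqP io yi]]].
  move=> yo; apply/existsP; move: yo; apply: contraR.
  rewrite negb_exists => /forallP nex; apply/eqP/colP=> i.
  rewrite [LHS]mxE [RHS]mxE; case: ifP => // io; apply/eqP.
  by have := nex i; rewrite io negbK.
apply/eqP=> /colP/(_ i); rewrite [LHS]mxE [RHS]mxE -io eqxx => /eqP.
by rewrite (negPf yi).
Qed.

Hypothesis acyc : acyclic_net outV inV E.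

Local Notation transfer g := (transfer_mx outV inV E S (code_alpha g) (code_beta g)).

Definition unresolved (x : 'rV[F]_mu) (t : V) : {set code} :=
  [set g | [forall i, (inV i == t) ==> ((x *m transfer g *m adj) 0 i == 0)]].

Lemma card_unresolved (x : 'rV[F]_mu) t r : x != 0 -> t != S ->
    (forall Om : {set V}, S \in Om -> t \notin Om -> (r <= \rank (cut Om))%N) ->
  (#|unresolved x t| * q ^ r <= 2 ^ #|V| * #|{: code}|)%N.
Proof.
move=> x0 tS hcut.
pose out (g : code) := x *m transfer g.
pose sep (Om : {set V}) := (S \in Om) && (t \notin Om).
pose A (Om : {set V}) := [set o | outV o \in Om].
pose Y (Om : {set V}) :=
  [set y : 'rV_nO |
     (y *m cut Om == 0) && [forall o, (o \notin A Om) ==> (y 0 o == 0)]].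
pose K y := [set g : code | [forall o, g o *m load x y o == (y 0 o)%:M]].
have outP g : g \in K (out g).
  rewrite inE; apply/forallP=> o; apply/eqP/rowP=> j; rewrite ord1 -load_eq.
  rewrite [RHS]mxE mulr1n /out; congr (fun_of_matrix _ _ _); apply/esym.
  exact/(transfer_mxP _ acyc).
have out0 g o : outV o \notin seen (out g) -> out g 0 o = 0.
  rewrite -(load_neq0 _ _ x0) negbK => /eqP lo.
  have := outP g; rewrite inE => /forallP/(_ o).
  rewrite lo mulmx0 => /eqP/matrixP/(_ 0 0).
  by rewrite !mxE mulr1n.
have outY g : out g \in Y (seen (out g)).
  rewrite inE; apply/andP; split; last first.
    by apply/forallP=> o; apply/implyP; rewrite inE => /out0->.
  apply/eqP/rowP=> i; rewrite [RHS]mxE.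
  have [iOm|iOm] := boolP (inV i \in seen (out g)).
    by rewrite mxE big1 // => o _; rewrite [X in _ * X]mxE iOm /= andbF mulr0.
  rewrite -(adj_mx_cut _ iOm) //; last exact: out0.
  apply/eqP; apply: contraR iOm => yi; rewrite !inE; apply/orP; right.
  by apply/existsP; exists i; rewrite eqxx.
have sepP g : g \in unresolved x t -> sep (seen (out g)).
  rewrite inE /sep !inE eqxx (negPf tS) /= => /forallP gt.
  rewrite negb_exists; apply/forallP=> i; rewrite negb_and negbK -implybE.
  exact: gt.
(* Each [y] with [seen y = Om] is consistent with at most a fraction 1/q^|A| of the codes, and there
   are at most q^(|A| - r) such [y] in [Y Om]. Multiplying through by q^|A| avoids subtraction in
   exponents. *)
have cardK Om : sep Om ->
    (\sum_(y in Y Om | seen y == Om) #|K y| * q ^ r <= #|{: code}|)%N.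
  move=> /andP[SOm tOm].
  have q_gt0 n : (0 < q ^ n)%N by rewrite expn_gt0 (ltnW (finNzRing_gt1 F)).
  rewrite -(leq_pmul2r (q_gt0 #|A Om|)) -big_distrl /=.
  have cardY : (#|Y Om| * q ^ r <= q ^ #|A Om|)%N.
    apply: leq_trans (@card_kernel_supported _ _ _ (cut Om) (A Om) _); last first.
      by move=> o i; rewrite inE mxE => /negPf->.
    by rewrite leq_mul2l leq_pexp2l ?hcut ?orbT //; have := q_gt0 1%N; rewrite expn1.
  apply: leq_trans (leq_mul (leqnn _) cardY).
  rewrite mulnAC [leqRHS]mulnA leq_mul2r; apply/orP; right.
  rewrite big_distrl /= mulnC -sum_nat_const big_mkcondr.
  apply: leq_sum => y _; case: eqP => // seeny.
  apply: leq_trans (card_ffun_affine (load x y) (fun o => (y 0 o)%:M)).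
  rewrite leq_mul2l leq_pexp2l ?orbT //; first by have := q_gt0 1%N; rewrite expn1.
  by apply/subset_leq_card/subsetP=> o; rewrite !inE load_neq0 // seeny.
(* Unresolved codes are sorted by the cut that their symbols determine, then by the symbols; each
   class lies in a single [K y]. *)
have -> : #|unresolved x t| = (\sum_(Om | sep Om) \sum_(y in Y Om | seen y == Om)
     \sum_(g in unresolved x t | out g == y) 1)%N.
  rewrite -sum1_card (partition_big (seen \o out) sep) //=; apply: eq_bigr => Om _.
  rewrite (partition_big out (fun y => (y \in Y Om) && (seen y == Om))) /=; last first.
    by move=> g /andP[_ /eqP <-]; rewrite outY eqxx.
  apply: eq_bigr => y /andP[_ /eqP seeny]; apply: eq_bigl => g.
  by case: (out g =P y) => [->|]; rewrite ?andbF // seeny eqxx !andbT.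
rewrite big_distrl /=.
apply: (@leq_trans (\sum_(Om | sep Om) #|{: code}|)%N); last first.
  rewrite sum_nat_const leq_mul2r; apply/orP; right.
  rewrite -cardsT -card_powerset; apply/subset_leq_card/subsetP=> Om _.
  by rewrite powersetE subsetT.
apply: leq_sum => Om sepOm; apply: leq_trans (cardK _ sepOm).
rewrite big_distrl /=; apply: leq_sum => y _; rewrite leq_mul2r; apply/orP; right.
rewrite sum1dep_card; apply/subset_leq_card/subsetP=> g.
by rewrite inE => /andP[_ /eqP <-]; exact: outP.
Qed.

Lemma exists_resolving_code N (T : 'I_N -> V) : (N * 2 ^ #|V| < q)%N ->
    (forall j, T j != S) ->
    (forall j (Om : {set V}), S \in Om -> T j \notin Om -> (mu <= \rank (cut Om))%N) ->
  exists (a : 'M[F]_(mu, nO)) b, forall j, resolves outV inV E S a b (T j).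
Proof.
move=> qbig TS hcut.
have q_gt1 : (1 < q)%N by apply: finNzRing_gt1.
suff [g good] : exists g : code, forall j x, g \in unresolved x (T j) -> x = 0.
  exists (code_alpha g), (code_beta g) => j x xj; apply: (good j).
  by rewrite inE; apply/forallP=> i; apply/implyP=> /eqP /xj ->.
pose bad (g : code) := [exists j, [exists x, (x != 0) && (g \in unresolved x (T j))]].
have [g|allbad] := pickP (predC bad).
  move=> /= gbad; exists g => j x gx; apply: contraNeq gbad => x0.
  by apply/existsP; exists j; apply/existsP; exists x; rewrite x0.
(* Assuming every code bad, the triples of a destination, a nonzero source vector and a code failing
   on them are counted in two ways. *)
pose cnt := (\sum_j \sum_(x : 'rV[F]_mu | x != 0%R) #|unresolved x (T j)|)%N.
(* The bad [x] of a given code are closed under nonzero scaling. *)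
have lower : (#|{: code}| * q.-1 <= cnt)%N.
  rewrite /cnt.
  under eq_bigr => j _ do under eq_bigr => x _ do rewrite -sum1_card big_mkcond.
  under eq_bigr => j _ do rewrite exchange_big /=.
  rewrite exchange_big /= -sum_nat_const; apply: leq_sum => g _.
  have /existsP[j /existsP[x /andP[x0 gx]]] := negbFE (allbad g).
  rewrite (bigD1 j) //= (leq_trans _ (leq_addr _ _)) // -big_mkcondr sum1dep_card.
  rewrite -(cardsC1 (0 : F)) -(card_in_imset (f := fun c : F => c *: x)); last first.
    move=> c d _ _ /eqP; rewrite -subr_eq0 -scalerBl scaler_eq0 (negPf x0) orbF.
    by rewrite subr_eq0 => /eqP.
  apply/subset_leq_card/subsetP=> _ /imsetP[c + ->]; rewrite !inE => c0.
  rewrite scaler_eq0 negb_or c0 x0 /=; apply/forallP=> i; apply/implyP=> it.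
  move: gx; rewrite inE => /forallP/(_ i).
  rewrite it -!scalemxAl [fun_of_matrix (c *: _) _ _]mxE.
  by move=> /eqP->; rewrite mulr0.
have upper : (cnt * q ^ mu <= N * 2 ^ #|V| * #|{: code}| * (q ^ mu).-1)%N.
  rewrite /cnt big_distrl /=.
  apply: (@leq_trans (\sum_(j < N) (q ^ mu).-1 * (2 ^ #|V| * #|{: code}|))%N); last first.
    by rewrite sum_nat_const card_ord mulnCA [leqLHS]mulnC -!mulnA.
  apply: leq_sum => j _; rewrite big_distrl /=.
  have -> : (q ^ mu).-1 = #|[set~ (0 : 'rV[F]_mu)]| by rewrite cardsC1 card_mx mul1n.
  rewrite -sum_nat_const.
  rewrite [leqRHS](eq_bigl (fun x => x != 0)) => [|x]; last by rewrite !inE.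
  by apply: leq_sum => x x0; apply: card_unresolved => //; apply: hcut.
have code_gt0 : (0 < #|{: code}|)%N by apply/card_gt0P; exists [ffun=> 0].
have qmu_gt0 : (0 < q ^ mu)%N by rewrite expn_gt0 (ltnW q_gt1).
(* As N 2^|V| is at most q - 1, the two counts combine and cancel to q^mu <= q^mu - 1, which is
   absurd. *)
have : (#|{: code}| * q.-1 * q ^ mu <= q.-1 * #|{: code}| * (q ^ mu).-1)%N.
  apply: leq_trans (leq_trans upper _); first by rewrite leq_mul2r lower orbT.
  by rewrite !leq_mul2r -ltnS prednK ?(ltnW q_gt1) // qbig !orbT.
rewrite [(q.-1 * _)%N]mulnC leq_pmul2l ?muln_gt0 ?code_gt0 ?ltn_predRL //.
by rewrite -ltnS prednK // ltnn.
Qed.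

End RandomCode.

(** * Independence of the cut rank from the field, and the minimum cut *)

Lemma mxrank_cut_mx (F : finFieldType) p (V : finType) (nO nI : nat)
    (outV : 'I_nO -> V) (inV : 'I_nI -> V) (E : 'I_nO -> 'I_nI -> bool) Om :
    p \in [pchar F] ->
  \rank (cut_mx F outV inV E Om) = \rank (cut_matrix p outV inV E Om).
Proof.
(* In characteristic [p], [F] is an algebra over ['F_p], and a field embedding preserves rank. *)
move=> pF; rewrite -(mxrank_map (in_alg (pPrimeCharType pF))); congr (\rank _).
by apply/matrixP=> o i; rewrite !mxE; case: ifP; rewrite ?rmorph1 ?rmorph0.
Qed.

Lemma bigminn_leq (I : eqType) (r : seq I) (P : pred I) (f : I -> nat) n0 i :
  i \in r -> P i -> (\big[minn/n0]_(j <- r | P j) f j <= f i)%N.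
Proof.
move=> + Pi; elim: r => // j r IHr; rewrite inE big_cons => /predU1P[<-|/IHr le_r].
  by rewrite Pi geq_minl.
by case: ifP => // _; rewrite geq_min le_r orbT.
Qed.

Lemma leq_mincutP p (V : finType) (nO nI : nat)
    (outV : 'I_nO -> V) (inV : 'I_nI -> V) (E : 'I_nO -> 'I_nI -> bool) S t m :
  t != S ->
  (m <= mincut p outV inV E S t)%N <->
  (forall Om : {set V}, S \in Om -> t \notin Om ->
     (m <= \rank (cut_matrix p outV inV E Om))%N).
Proof.
move=> tS; rewrite /mincut; split=> [mle Om SOm tOm|mle].
  by apply: leq_trans mle _; apply: bigminn_leq; rewrite ?mem_index_enum ?SOm.
(* The default value [nO] of the minimum is harmless: since [t != S], the cut [[set S]] exists and
   its rank is at most [nO]. *)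
have mnO : (m <= nO)%N.
  apply: leq_trans (mle [set S] _ _) (rank_leq_row _); by rewrite inE.
elim/big_ind: _ => // [a b ma mb|Om /andP[]]; last exact: mle.
by rewrite leq_min ma.
Qed.

Local Close Scope ring_scope.

Theorem theorem4 (p : nat) (hp : prime p) (V : finType) (nO nI : nat)
  (outV : 'I_nO -> V) (inV : 'I_nI -> V) (E : 'I_nO -> 'I_nI -> bool)
  (S : V) (mu N : nat) (T : 'I_N -> V) :
  acyclic_net outV inV E ->
  (forall j, T j != S) ->
  (solvable p outV inV E S mu T <->
   forall j, mu <= mincut p outV inV E S (T j)).
Proof.
move=> acyc TS; split=> [[F [pF /(linear_solutionP _ _ _ acyc)[a [b res]]]] j|cuts].
  apply/leq_mincutP=> // Om SOm TOm; rewrite -(mxrank_cut_mx _ _ _ _ pF).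
  exact: resolves_rank_cut acyc _ _ _ _ (res j) SOm TOm.
(* The field has p^(N 2^|V| + 1) elements: the exponent is positive and already exceeds N 2^|V|. *)
have [F pF cardF] := pPrimePowerField hp (ltn0Sn (N * 2 ^ #|V|)).
exists F; split=> //; apply/(linear_solutionP _ _ _ acyc).
apply: exists_resolving_code => // [|j Om SOm TOm].
  by rewrite cardF (ltn_trans (ltnSn _)) // ltn_expl ?prime_gt1.
by rewrite (mxrank_cut_mx _ _ _ _ pF); move: Om SOm TOm; apply/leq_mincutP.
Qed.
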